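(* There exist absolute constants $c_1,c_2>0$ and a sequence $\epsilon_m\ge 0$ with $\epsilon_m\to0$ as $m\to\infty$ such that for all integers $k\ge 0$ and $m\ge 1$, $$c_1\left(\frac12\right)^{(k+m)/2}\ \le\ \mathbb{P}\left(k+1,\ k+2,\ \dots,\ \text{and}\ k+m\notin A+A\right)\ \le\ c_2\left(\frac12\right)^{(k+m)/2}(1+\epsilon_m)^k.$$ More precisely, the upper bound has the form $c_2\,(1/2)^{(k+m)/2}\,2^{k/m}$ (i.e. one may take $1+\epsilon_m=2^{1/m}$). Consequently $$\lambda_{0,1,2,\dots,m}\ \to\ \left(\frac12\right)^{1/2}\qquad\text{as } m\to\infty .$$
   Context: For integers $a\le b$, $[a,b]$ denotes the set of integers $x$ with $a\le x\le b$. For a set $X$ of integers, $X+X=\{x+y: x,y\in X\}$. For given integers $0\le b_1<\cdots<b_s$, the probability $\mathbb{P}(b_1,\dots,\text{and }b_s\notin A+A)$ is the probability that none of $b_1,\dots,b_s$ lies in $A+A$, where $A$ is chosen uniformly at random among the subsets of $[0,n-1]$ with $n>b_s$; it does not depend on the choice of such $n$. For fixed integers $0\le a_1<\cdots<a_m$, $\lambda_{a_1,\dots,a_m}$ denotes the (unique) real number such that $\mathbb{P}(k+a_1,\dots,\text{and }k+a_m\notin A+A)$ is, for all $k\ge 0$, bounded above and below by positive constants (depending on the $a_i$ but not on $k$) times $\lambda_{a_1,\dots,a_m}^{\,k}$; such a number exists. *)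

(* Defs.v *)
From HB Require Import structures.
From mathcomp Require Import all_boot all_order all_algebra.
From mathcomp Require Import all_classical all_reals all_analysis.
From mathcomp Require Import lra.

Set Implicit Arguments.
Unset Strict Implicit.
Unset Printing Implicit Defensive.

Import Order.TTheory GRing.Theory Num.Theory.
Import numFieldNormedType.Exports.

Local Open Scope classical_set_scope.
Local Open Scope ring_scope.

(* The sumset A + A, as a predicate on nat. *)
Definition sumset (n : nat) (A : {set 'I_n}) : pred nat :=
  [pred b | [exists x in A, exists y in A, (x + y == b)%N]].

Definition missing_sets (n : nat) (B : seq nat) : {set {set 'I_n}} :=
  [set A : {set 'I_n} | all (fun b => b \notin sumset A) B]%SET.

Definition missing_prob_in (R : realType) (n : nat) (B : seq nat) : R :=
  #|missing_sets n B|%:R / #|{set 'I_n}|%:R.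

(* The ambient interval [0, n-1] is the smallest one containing B; any larger
   one gives the same value, see missing_prob_inE. *)
Definition missing_prob (R : realType) (B : seq nat) : R :=
  missing_prob_in R (\max_(b <- B) b).+1 B.

Definition is_growth_rate (R : realType) (a : seq nat) (l : R) : Prop :=
  exists c1 c2 : R, [/\ 0 < c1, 0 < c2 &
    forall k : nat, c1 * l ^+ k <= missing_prob R [seq (k + x)%N | x <- a]
                 /\ missing_prob R [seq (k + x)%N | x <- a] <= c2 * l ^+ k].

(* Definite description: the growth rate is unique by is_growth_rate_uniq;
   the default value 0 is never a growth rate. *)
Definition lambda (R : realType) (a : seq nat) : R :=
  xget 0 [set l : R | is_growth_rate a l].

Lemma card_set_type (T : finType) : #|{set T}| = (2 ^ #|T|)%N.
Proof.
rewrite -[#|T|]cardsT -card_powerset -[LHS]cardsT; apply: eq_card => A.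
by rewrite !inE finset.subsetT.
Qed.

Lemma card_missing_setsS (n : nat) (B : seq nat) :
  all (fun b => b < n)%N B ->
  #|missing_sets n.+1 B| = (#|missing_sets n B| * 2)%N.
Proof.
move=> /allP ltB.
pose w (i : 'I_n) : 'I_n.+1 := widen_ord (leqnSn n) i.
pose f (A : {set 'I_n.+1}) := ([set i | w i \in A]%SET, ord_max \in A).
have f_inj : injective f.
  move=> A A' [eqA eqM]; apply/setP => i.
  have [lt_in|] := ltnP i n; last first.
    move=> le_ni; suff -> : i = ord_max by [].
    by apply/val_inj/eqP; rewrite eqn_leq le_ni -ltnS ltn_ord.
  have -> : i = w (Ordinal lt_in) by apply: val_inj.
  by move/setP/(_ (Ordinal lt_in)): eqA; rewrite !inE.
have f_bij : bijective f.
  apply: inj_card_bij => //.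
  by rewrite card_prod card_bool !card_set_type !card_ord expnSr.
have -> : missing_sets n.+1 B = (f @^-1: (finset.setX (missing_sets n B) [set: bool]))%SET.
  apply/setP => A; rewrite !inE andbT; apply: eq_in_all => b bB; congr (~~ _).
  apply/exists_inP/exists_inP => -[x xA /exists_inP[y yA /eqP xyb]].
    have ltb := ltB b bB.
    have xn : (x < n)%N by apply: leq_ltn_trans ltb; rewrite -xyb leq_addr.
    have yn : (y < n)%N by apply: leq_ltn_trans ltb; rewrite -xyb leq_addl.
    exists (Ordinal xn); first by rewrite inE; congr (_ \in A): xA; apply: val_inj.
    apply/exists_inP; exists (Ordinal yn); last by rewrite -xyb.
    by rewrite inE; congr (_ \in A): yA; apply: val_inj.
  exists (w x); first by move: xA; rewrite inE.
  by apply/exists_inP; exists (w y); [move: yA; rewrite inE | rewrite -xyb].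
rewrite on_card_preimset; first by rewrite cardsX cardsT card_bool.
exact: onW_bij.
Qed.

Lemma missing_prob_inE (R : realType) (n : nat) (B : seq nat) :
  all (fun b => b < n)%N B -> (0 < n)%N ->
  missing_prob_in R n B = missing_prob R B.
Proof.
move=> /allP ltB n0; rewrite /missing_prob.
set m := \max_(b <- B) b.
have lemn : (m < n)%N.
  rewrite -(prednK n0) ltnS /m; apply/bigmax_leqP_seq => b bB _.
  by rewrite -ltnS (prednK n0) ltB.
have leB b : b \in B -> (b <= m)%N by move=> bB; exact: leq_bigmax_seq.
rewrite -(subnK lemn); elim: (n - m.+1)%N => [|d IHd]; first by rewrite add0n.
rewrite -IHd addSn /missing_prob_in card_missing_setsS; last first.
  by apply/allP => b /leB bm; rewrite addnS ltnS (leq_trans bm)// leq_addl.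
rewrite !card_set_type !card_ord expnSr !natrM -mulf_div divff ?mulr1//.
Qed.

Lemma missing_prob_gt0 (R : realType) (B : seq nat) : 0 < missing_prob R B.
Proof.
rewrite divr_gt0 ?ltr0n//; apply/card_gt0P; last by exists finset.set0.
exists finset.set0; rewrite inE; apply/allP => b _.
by apply/exists_inP => -[x]; rewrite inE.
Qed.

Lemma is_growth_rate_gt0 (R : realType) (a : seq nat) (l : R) :
  is_growth_rate a l -> 0 < l.
Proof.
move=> [c1 [c2 [c1_gt0 c2_gt0 /(_ 1)[_]]]] /(lt_le_trans (missing_prob_gt0 _ _)).
by rewrite expr1 pmulr_rgt0.
Qed.

Lemma is_growth_rate_uniq (R : realType) (a : seq nat) (l l' : R) :
  is_growth_rate a l -> is_growth_rate a l' -> l = l'.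
Proof.
suff le_rate (u v : R) : is_growth_rate a u -> is_growth_rate a v -> u <= v.
  by move=> gl gl'; apply/eqP; rewrite eq_le !le_rate.
move=> gu gv; have u0 := is_growth_rate_gt0 gu; have v0 := is_growth_rate_gt0 gv.
rewrite leNgt; apply/negP => ltvu.
have [c1 [d2 [c1_gt0 _ Hu]]] := gu; have [d1 [c2 [_ _ Hv]]] := gv.
have ratio_lt1 : `|v / u| < 1.
  by rewrite gtr0_norm ?divr_gt0// ltr_pdivrMr// mul1r.
have /cvgrPdist_lt/(_ (c1 / (c2 + c1))) := cvg_expr ratio_lt1.
have c2_gt0 : 0 < c2.
  have := lt_le_trans (missing_prob_gt0 _ _) (Hv 0%N).2.
  by rewrite expr0 mulr1.
rewrite divr_gt0 ?addr_gt0// => /(_ isT)[N _ /(_ N (leqnn N))] /=.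
rewrite sub0r normrN gtr0_norm ?exprn_gt0 ?divr_gt0// expr_div_n.
rewrite ltr_pdivrMr ?exprn_gt0// mulrAC ltr_pdivlMr ?addr_gt0//.
have := le_trans (Hu N).1 (Hv N).2.
have : 0 < c1 * v ^+ N by rewrite mulr_gt0 ?exprn_gt0.
nra.
Qed.

(* Main.v *)
Require Import Defs.
From HB Require Import structures.
From mathcomp Require Import all_boot all_order all_algebra.
From mathcomp Require Import all_classical all_reals all_analysis.
From mathcomp Require Import zify ring lra.

Import Order.TTheory GRing.Theory Num.Theory.
Import numFieldNormedType.Exports.

Local Open Scope classical_set_scope.
Local Open Scope ring_scope.

(** A set [A] misses the sums [K, ..., K + m - 1] exactly when it is an
independent set of the graph on [0, K + m) whose edges (and loops) are the
pairs with sum in that window. All probabilities become counts of independent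
sets, and three facts suffice: the count for a union is at most the product of
the counts for its pieces ([card_independent_setsU]), pieces with no edge between
them multiply exactly ([card_independent_setsU_ge]), and a complete bipartite
pair of blocks of length [b] carries at most [2 * 2 ^ b] independent sets
instead of [2 ^ (2 * b)] ([card_independent_sets_biclique]).

Lower bound: no two elements of the upper half of [0, K + m) are joined, so
each of its subsets counts.

Upper bound: sort the independent sets by their least element [j]. A loop at
[j] forbids [K <= 2 * j < K + m], so either [j] is in the upper half, which
gives the main term [2 ^ ((K + m) / 2)], or [2 * j < K]. In the latter case the
[m] neighbours of [j] are absent, the [j] elements above them are
unconstrained by this argument, and what remains is the central interval
(j, K - j). There, with [L = uphalf m], the two blocks of length [L] at the ends
of an interval symmetric about [(K + L - 1) / 2] have all their cross sums in the
window. Peeling such blocks one pair after the other costs a factor 2 for each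
[2 * L >= m] elements, and this is the origin of [2 ^ (k / m)]. The terms of the
sum over [j] are smaller than the main term by a factor of order
[2 ^ (- m / 4)], which absorbs the number [L] of terms of each size: the
constant stays absolute ([card_independent_sum_graph_le]).

Growth rate: with [m] fixed, cut [l] elements off each end of the graph for
[k + 2 * l]. The middle is a copy of the graph for [k], the two ends form a copy
of the outer part of the graph for [2 * l], and emptying a block of [m] elements
separates them, at the cost of a constant factor. Hence
[p (k + 2 * l)] is comparable to [p k * p (2 * l)]
([missing_prob_iota_quasimul]), so [p (2 * l)] is quasi-multiplicative and, by
a Fekete argument, comparable to a geometric sequence
([quasi_multiplicative_growth]); the two parities of the index are then
handled separately with the same ratio. This shows that [lambda] is a genuine
growth rate, and comparing it with the explicit bounds puts it between
[(1 / 2) ^ (1 / 2)] and [2 ^ (1 / m) * (1 / 2) ^ (1 / 2)]. *)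

Section Counting.
Import mathcomp.boot.fintype mathcomp.boot.finset.
Set Implicit Arguments.
Unset Strict Implicit.
Unset Printing Implicit Defensive.
Local Open Scope nat_scope.
Local Open Scope set_scope.

(** * Counting independent sets *)

Definition independent_sets (T : finType) (e : rel T) (D : {set T}) :
    {set {set T}} :=
  [set A : {set T} | (A \subset D) && [forall x in A, forall y in A, ~~ e x y]].

Lemma independent_setsP (T : finType) (e : rel T) (D A : {set T}) :
  reflect (A \subset D /\ {in A &, forall x y, ~~ e x y})
          (A \in independent_sets e D).
Proof.
rewrite inE; apply: (iffP andP) => -[sAD indA]; split=> //.
  by move=> x y xA yA; move/forall_inP: indA => /(_ x xA)/forall_inP/(_ y yA).
by apply/forall_inP => x xA; apply/forall_inP => y yA; exact: indA.
Qed.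

Lemma card_independent_sets_le (T : finType) (e : rel T) (D : {set T}) :
  #|independent_sets e D| <= 2 ^ #|D|.
Proof.
rewrite -card_powerset; apply/subset_leq_card/subsetP => A.
by case/independent_setsP=> sAD _; rewrite powersetE.
Qed.

Lemma independent_setsS (T : finType) (e : rel T) (D D' : {set T}) :
  D \subset D' -> #|independent_sets e D| <= #|independent_sets e D'|.
Proof.
move=> sDD'; apply/subset_leq_card/subsetP => A.
case/independent_setsP=> sAD indA; apply/independent_setsP; split=> //.
exact: subset_trans sAD sDD'.
Qed.

(** An independent set is determined by its traces on the two pieces, and both
traces are independent. *)
Lemma card_independent_setsU (T : finType) (e : rel T) (D D' : {set T}) :
  #|independent_sets e (D :|: D')| <=
  #|independent_sets e D| * #|independent_sets e D'|.
Proof.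
rewrite -cardsX -(@card_in_imset _ _ (fun A => (A :&: D, A :&: D'))).
  apply/subset_leq_card/subsetP => _ /imsetP[A /independent_setsP[_ indA] ->].
  rewrite inE /=; apply/andP; split; apply/independent_setsP;
    split; rewrite ?subsetIr // => x y; rewrite !inE;
    by case/andP=> xA _ /andP[yA _]; exact: indA.
move=> A B /independent_setsP[sA _] /independent_setsP[sB _] [eqD eqD'].
by rewrite -(setIidPl sA) -(setIidPl sB) !setIUr eqD eqD'.
Qed.

Lemma card_independent_setsU_ge (T : finType) (e : rel T) (D D' : {set T}) :
    D :&: D' = set0 ->
    (forall x y, x \in D -> y \in D' -> ~~ e x y && ~~ e y x) ->
  #|independent_sets e D| * #|independent_sets e D'| <=
  #|independent_sets e (D :|: D')|.
Proof.
move=> D0 noe.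
rewrite -cardsX -(@card_in_imset _ _ (fun AB : {set T} * {set T} => AB.1 :|: AB.2)).
  apply/subset_leq_card/subsetP => Z /imsetP[[A B] /setXP[/= ]].
  move=> /independent_setsP[sA indA] /independent_setsP[sB indB] ->.
  apply/independent_setsP; split; first exact: setUSS.
  move=> x y /setUP[xA|xB] /setUP[yA|yB]; [exact: indA| | |exact: indB].
    by have /andP[] := noe x y (subsetP sA _ xA) (subsetP sB _ yB).
  by have /andP[] := noe y x (subsetP sA _ yA) (subsetP sB _ xB).
have parts (A B : {set T}) : A \subset D -> B \subset D' ->
    ((A :|: B) :&: D = A) * ((A :|: B) :&: D' = B).
  move=> sA sB; rewrite !setIUl (setIidPl sA) (setIidPl sB).
  have -> : B :&: D = set0.
    by apply/eqP; rewrite -subset0 -D0 setIC setIS.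
  have -> : A :&: D' = set0 by apply/eqP; rewrite -subset0 -D0 setSI.
  by rewrite setU0 set0U.
move=> [A B] [A' B'] /setXP[/independent_setsP[/= sA _] /independent_setsP[/= sB _]].
move=> /setXP[/independent_setsP[/= sA' _] /independent_setsP[/= sB' _]] /= eqU.
have [pA pB] := parts _ _ sA sB; have [pA' pB'] := parts _ _ sA' sB'.
by congr pair; [rewrite -pA eqU pA' | rewrite -pB eqU pB'].
Qed.

(** Direct images under [f] of independent sets stay independent because [f]
creates no edge; injectivity of [f] on [D] makes taking images injective. *)
Lemma independent_sets_transport (T T' : finType) (e : rel T) (e' : rel T')
    (f : T -> T') (D : {set T}) (D' : {set T'}) :
    {in D &, injective f} -> {in D, forall x, f x \in D'} ->
    {in D &, forall x y, e' (f x) (f y) -> e x y} ->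
  #|independent_sets e D| <= #|independent_sets e' D'|.
Proof.
move=> injf fD ef.
rewrite -(@card_in_imset _ _ (fun A : {set T} => f @: A)).
  apply/subset_leq_card/subsetP => _ /imsetP[A /independent_setsP[sA indA] ->].
  have sub := subsetP sA.
  apply/independent_setsP; split.
    by apply/subsetP => _ /imsetP[x /sub xD ->]; exact: fD.
  move=> _ _ /imsetP[x xA ->] /imsetP[y yA ->].
  by apply: contra (indA x y xA yA); apply: ef; exact: sub.
have subim (A B : {set T}) : A \subset D -> B \subset D ->
    f @: A = f @: B -> A \subset B.
  move=> /subsetP sA /subsetP sB eqf; apply/subsetP => x xA.
  have /imsetP[y yB /injf xy] : f x \in f @: B by rewrite -eqf imset_f.
  by rewrite (xy (sA x xA) (sB y yB)).
move=> A B /independent_setsP[sA _] /independent_setsP[sB _] eqf.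
by apply/eqP; rewrite eqEsubset; apply/andP; split; apply: subim.
Qed.

(** An independent set containing [x] is determined by its other elements, all
of them non-neighbours of [x]; a loop at [x] excludes this case. *)
Lemma card_independent_setsU1 (T : finType) (e : rel T) (x : T) (D : {set T}) :
  #|independent_sets e (x |: D)| <= #|independent_sets e D| +
    (if e x x then 0 else #|independent_sets e [set y in D | ~~ e x y]|).
Proof.
pose F := independent_sets e (x |: D).
rewrite -(cardsID [set A : {set T} | x \in A] F) addnC leq_add //.
  apply/subset_leq_card/subsetP => A; rewrite inE => /andP[xA].
  case/independent_setsP=> /subsetP sA indA; apply/independent_setsP; split=> //.
  apply/subsetP => y yA; have := sA y yA; rewrite !inE in xA *.
  by case: eqP => // yx; rewrite -yx yA in xA.
case: ifPn => exx.
  rewrite leqn0 cards_eq0 -subset0; apply/subsetP => A; rewrite inE.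
  case/andP=> /independent_setsP[_ indA]; rewrite inE => xA.
  by have := indA x x xA xA; rewrite exx.
rewrite -(@card_in_imset _ _ (fun A : {set T} => A :\ x)).
  apply/subset_leq_card/subsetP => B /imsetP[A /setIP[]].
  move=> /independent_setsP[sA indA] + ->; rewrite inE => xA.
  apply/independent_setsP; split; last first.
    by move=> y z /setD1P[_ yA] /setD1P[_ zA]; exact: indA.
  apply/subsetP => y /setD1P[yx yA]; rewrite inE indA // andbT.
  by have := subsetP sA y yA; rewrite in_setU1 (negPf yx).
move=> A B /setIP[_ xA] /setIP[_ xB]; rewrite !inE in xA xB => eqAB.
by rewrite -[A](setD1K xA) -[B](setD1K xB) eqAB.
Qed.

(** An independent set cannot meet both sides. *)
Lemma card_independent_sets_biclique (T : finType) (e : rel T) (I J : {set T}) :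
    {in I & J, forall x y, e x y} ->
  #|independent_sets e (I :|: J)| <= 2 ^ #|I| + 2 ^ #|J|.
Proof.
move=> eIJ; rewrite -!card_powerset.
apply: leq_trans (leq_card_setU _ _); apply/subset_leq_card/subsetP => A.
case/independent_setsP=> sA indA; rewrite inE !powersetE.
have [/eqP AJ0|/set0Pn[y /setIP[yA yJ]]] := boolP (A :&: J == set0).
  by rewrite -(setIidPl sA) setIUr AJ0 setU0 subsetIr.
have [/eqP AI0|/set0Pn[x /setIP[xA xI]]] := boolP (A :&: I == set0).
  by rewrite -(setIidPl sA) setIUr AI0 set0U subsetIr orbT.
by have := indA x y xA yA; rewrite eIJ.
Qed.

(** * The graph of forbidden sums *)

(** The vertices are [0, n) and the forbidden sums form the window [K, K + m). *)
Definition sum_graph (n K m : nat) : rel 'I_n := fun x y => K <= x + y < K + m.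
Arguments sum_graph n K m _ _ : clear implicits.

Definition ord_itv (n a b : nat) : {set 'I_n} := [set i : 'I_n | a <= i < b].

Lemma ord_itvE (n a b : nat) (i : 'I_n) : (i \in ord_itv n a b) = (a <= i < b).
Proof. by rewrite inE. Qed.

Lemma mem_map_val_ord_itv (n a b i : nat) :
  (i \in [seq val j | j <- enum (ord_itv n a b)]) = (a <= i < minn b n).
Proof.
apply/mapP/idP => [[j]|].
  by rewrite mem_enum ord_itvE => ab -> /=; have := ltn_ord j; lia.
move=> ab; have lt_in : i < n by lia.
by exists (Ordinal lt_in); rewrite // mem_enum ord_itvE /=; lia.
Qed.

Lemma card_ord_itv (n a b : nat) : #|ord_itv n a b| = minn b n - a.
Proof.
rewrite cardE -(size_map val) -(size_iota a (minn b n - a)).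
apply/perm_size/uniq_perm; last 1 first.
- by move=> i; rewrite mem_map_val_ord_itv mem_iota; lia.
- by rewrite (map_inj_uniq val_inj) enum_uniq.
- exact: iota_uniq.
Qed.

Lemma card_independent_itv_le (n a b : nat) (e : rel 'I_n) :
  #|independent_sets e (ord_itv n a b)| <= 2 ^ (b - a).
Proof.
apply: leq_trans (card_independent_sets_le _ _) _.
by rewrite leq_exp2l // card_ord_itv; lia.
Qed.

(** The interval [i, K + L - i) is symmetric about [(K + L - 1) / 2]. Its first and
last [b] elements, for [b <= L], form a complete bipartite pair: the cross sums
lie between [K + L - b] and [K + L + b - 2]. Removing two blocks of length [L]
replaces [2 ^ (2 * L)] by [2 * 2 ^ L], a square root up to a factor 2; the
exponent of the bound counts these factors. *)
Lemma card_independent_symmetric_itv (n K m L i : nat) :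
    0 < L -> L.*2 <= m.+1 ->
  #|independent_sets (sum_graph n K m) (ord_itv n i (K + L - i))| <=
  2 ^ (uphalf (K + L - i.*2) + (K + L - i.*2) %/ L.*2).+1.
Proof.
move=> L0 Lm; have [w] := ubnP (K + L - i.*2).
elim: w i => // w IHw i ltw.
have peel b : b <= L -> b.*2 <= K + L - i.*2 ->
    #|independent_sets (sum_graph n K m) (ord_itv n i (K + L - i))| <=
    #|independent_sets (sum_graph n K m) (ord_itv n (i + b) (K + L - (i + b)))| *
      2 ^ b.+1.
  move=> bL bn.
  have -> : ord_itv n i (K + L - i) = ord_itv n (i + b) (K + L - (i + b)) :|:
      (ord_itv n i (i + b) :|: ord_itv n (K + L - (i + b)) (K + L - i)).
    by apply/setP => x; rewrite !inE; lia.
  apply: leq_trans (card_independent_setsU _ _ _) _; rewrite leq_mul2l.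
  apply/orP; right; apply: leq_trans (card_independent_sets_biclique _) _.
    by move=> x y; rewrite !ord_itvE /sum_graph; lia.
  have cI : #|ord_itv n i (i + b)| <= b by rewrite card_ord_itv; lia.
  have cJ : #|ord_itv n (K + L - (i + b)) (K + L - i)| <= b.
    by rewrite card_ord_itv; lia.
  by rewrite expnS mul2n -addnn leq_add // leq_exp2l.
have [ltnL|leLn] := ltnP (K + L - i.*2) L.*2.
  set u := K + L - i.*2 in peel ltnL *.
(* A remainder shorter than two full blocks is cut in half, which leaves one
     middle element when its length is odd. *)
  apply: leq_trans (peel u./2 _ _) _; [by lia|by lia|].
  apply: leq_trans (leq_mul (card_independent_itv_le _ _ _) (leqnn _)) _.
  rewrite -expnD leq_exp2l // divn_small //; lia.
apply: leq_trans (peel L _ _) _ => //.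
apply: leq_trans (leq_mul (IHw (i + L) _) (leqnn _)) _; first by lia.
rewrite -expnD leq_exp2l //.
have -> : K + L - i.*2 = K + L - (i + L).*2 + L.*2 by lia.
rewrite divnDr // divnn double_gt0 L0; lia.
Qed.

(** The weight [2 ^ j] counts the subsets of the [j] largest elements of
[0, K + m), those left free once [j] is the least element. Dropping the [L - 1]
elements after [j] makes the interval symmetric about [(K + L - 1) / 2].
The leading exponent is independent of [j]: shortening the interval by two
elements compensates exactly one doubling of the weight. *)
Lemma weighted_central_itv_le (n K m L j : nat) :
    0 < L -> L.*2 <= m.+1 -> j.*2 < K ->
  2 ^ j * #|independent_sets (sum_graph n K m) (ord_itv n j.+1 (K - j))| <=
  2 ^ (uphalf (K + L) + (K - j.*2) %/ L.*2).
Proof.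
move=> L0 Lm jK.
(* Near the middle, the interval is too short to be peeled and the trivial
   bound suffices. *)
have [small|big] := ltnP K (L + j.*2).
  apply: leq_trans (leq_mul (leqnn _) (card_independent_itv_le _ _ _)) _.
  rewrite -expnD leq_exp2l // (leq_trans _ (leq_addr _ _)) //; lia.
have -> : ord_itv n j.+1 (K - j) = ord_itv n j.+1 (j + L) :|: ord_itv n (j + L) (K - j).
  by apply/setP => x; rewrite !inE; lia.
apply: leq_trans (leq_mul (leqnn _) (card_independent_setsU _ _ _)) _.
have -> : K - j = K + L - (j + L) by lia.
apply: leq_trans (leq_mul (leqnn _) (leq_mul (card_independent_itv_le _ _ _)
  (card_independent_symmetric_itv _ _ _ L0 Lm))) _.
rewrite -!expnD leq_exp2l //.
have : (K + L - (j + L).*2) %/ L.*2 <= (K - j.*2) %/ L.*2 by apply: leq_div2r; lia.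
lia.
Qed.

(** Each value of the quotient occurs at most [L] times, so the sum is at most
[L] times a geometric sum. *)
Lemma sum_exp2_div_le (K L : nat) : 0 < L ->
  \sum_(j < uphalf K) 2 ^ ((K - j.*2) %/ L.*2) <= L * 2 ^ (K %/ L.*2).+1.
Proof.
move=> L0; have [w] := ubnP K; elim: w K => // w IHw K ltw.
rewrite -(big_mkord xpredT (fun j => 2 ^ ((K - j.*2) %/ L.*2))).
have term j : 2 ^ ((K - j.*2) %/ L.*2) <= 2 ^ (K %/ L.*2).
  by rewrite leq_exp2l // leq_div2r // leq_subr.
have flat b : \sum_(0 <= j < b) 2 ^ ((K - j.*2) %/ L.*2) <= b * 2 ^ (K %/ L.*2).
  apply: leq_trans (_ : \sum_(0 <= j < b) 2 ^ (K %/ L.*2) <= _).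
    by apply: leq_sum => j _; exact: term.
  by rewrite sum_nat_const_nat subn0.
have [ltKL|leLK] := ltnP K L.*2.
  apply: leq_trans (flat _) _; rewrite leq_mul //; first lia.
  by rewrite leq_exp2l.
rewrite (@big_cat_nat _ _ _ L) //=; last by lia.
have -> : L * 2 ^ (K %/ L.*2).+1 = L * 2 ^ (K %/ L.*2) + L * 2 ^ (K %/ L.*2).
  by rewrite expnS mul2n -addnn mulnDr.
apply: leq_add; first exact: flat.
have -> : K %/ L.*2 = ((K - L.*2) %/ L.*2).+1.
  by rewrite -[in LHS](subnK leLK) divnDr // divnn double_gt0 L0 addn1.
rewrite -{1}[L]add0n big_addn.
have -> : uphalf K - L = uphalf (K - L.*2) by lia.
rewrite big_mkord; apply: leq_trans (IHw (K - L.*2) _); last by lia.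
by apply: eq_leq; apply: eq_bigr => j _; rewrite doubleD addnC subnDA.
Qed.

(** Deleting the vertices one at a time from the bottom amounts to classifying
the independent sets by their least element [i]. For [K <= 2 * i < K + m] the
vertex [i] is a loop and contributes nothing. *)
Lemma independent_sets_by_minimum (n K m j : nat) :
    n = K + m -> j <= uphalf K ->
  #|independent_sets (sum_graph n K m) (ord_itv n j n)| <=
  2 ^ (K + m)./2 + \sum_(j <= i < uphalf K)
    2 ^ i * #|independent_sets (sum_graph n K m) (ord_itv n i.+1 (K - i))|.
Proof.
move=> nE jK.
have step i : i < n -> #|independent_sets (sum_graph n K m) (ord_itv n i n)| <=
    #|independent_sets (sum_graph n K m) (ord_itv n i.+1 n)| +
    (if K <= i.*2 < K + m then 0 else
       2 ^ i * #|independent_sets (sum_graph n K m) (ord_itv n i.+1 (K - i))|).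
  move=> lt_in; pose x := Ordinal lt_in.
  have -> : ord_itv n i n = x |: ord_itv n i.+1 n.
    apply/setP => y; rewrite !inE -val_eqE /=; have := ltn_ord y; lia.
  apply: leq_trans (card_independent_setsU1 _ _ _) _; rewrite leq_add2l.
  rewrite /sum_graph /= addnn; case: ifP => // _.
(* The non-neighbours of [i] above it: those too large for the window,
     and the central interval. *)
  apply: leq_trans (_ : #|independent_sets (sum_graph n K m)
    (ord_itv n (n - i) n :|: ord_itv n i.+1 (K - i))| <= _).
    apply: independent_setsS; apply/subsetP => y; rewrite !inE /=.
    have := ltn_ord y; lia.
  apply: leq_trans (card_independent_setsU _ _ _) _; rewrite leq_mul //.
  apply: leq_trans (card_independent_itv_le _ _ _) _.
  by rewrite leq_exp2l //; lia.
have upper i : uphalf K <= i ->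
    #|independent_sets (sum_graph n K m) (ord_itv n i n)| <= 2 ^ (K + m)./2.
  have [w] := ubnP (n - i); elim: w i => // w IHw i ltw Ki.
  have [lti|gei] := ltnP i.*2 (K + m).
    apply: leq_trans (step i _) _; first by lia.
    have -> : K <= i.*2 < K + m by lia.
    by rewrite addn0 IHw //; lia.
  apply: leq_trans (card_independent_itv_le _ _ _) _.
  by rewrite leq_exp2l //; lia.
have [w] := ubnP (uphalf K - j); elim: w j jK => // w IHw j jK ltw.
move: jK; rewrite leq_eqVlt => /orP[/eqP ->|ltj].
  by rewrite big_geq // addn0 upper.
rewrite big_ltn //.
apply: leq_trans (step j _) _; first by lia.
have -> : K <= j.*2 < K + m = false by lia.
rewrite addnCA addnC leq_add2l; apply: IHw => //; lia.
Qed.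

(** The terms of [independent_sets_by_minimum] are at most [2 ^ uphalf (K + L)]
times those of [sum_exp2_div_le]. The value [L = uphalf m] is the only one with
both [L.*2 <= m.+1], under which blocks can be peeled, and [m <= L.*2], which
bounds the number of peelings by [K %/ m]. *)
Lemma card_independent_sum_graph_le (K m : nat) : 0 < m ->
  #|independent_sets (sum_graph (K + m) K m) setT| <=
  9 * 2 ^ ((K + m)./2 + K %/ m).
Proof.
move=> m0; pose L := uphalf m.
have L0 : 0 < L by rewrite /L; lia.
have Lm : L.*2 <= m.+1 by rewrite /L; lia.
have mL : m <= L.*2 by rewrite /L; lia.
have -> : [set: 'I_(K + m)] = ord_itv (K + m) 0 (K + m).
  by apply/setP => x; rewrite !inE ltn_ord.
apply: leq_trans (independent_sets_by_minimum (erefl _) (leq0n _)) _.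
rewrite big_mkord.
have -> : 9 * 2 ^ ((K + m)./2 + K %/ m) = 2 ^ ((K + m)./2 + K %/ m) +
    8 * 2 ^ ((K + m)./2 + K %/ m) by rewrite mulSn.
apply: leq_add; first by rewrite leq_exp2l // leq_addr.
have bound (i : 'I_(uphalf K)) : 2 ^ i *
    #|independent_sets (sum_graph (K + m) K m) (ord_itv (K + m) i.+1 (K - i))| <=
    2 ^ uphalf (K + L) * 2 ^ ((K - i.*2) %/ L.*2).
  rewrite -expnD; apply: weighted_central_itv_le => //.
  by have := ltn_ord i; lia.
apply: leq_trans (_ : \sum_(i < uphalf K)
  2 ^ uphalf (K + L) * 2 ^ ((K - i.*2) %/ L.*2) <= _).
  by apply: leq_sum => i _; exact: bound.
rewrite -big_distrr /=.
apply: leq_trans (leq_mul (leqnn _) (sum_exp2_div_le _ L0)) _.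
(* The room between [uphalf (K + L)] and [(K + m)./2] is about [L / 2], which
   pays for the factor [L]. *)
have L2 : L <= 2 * 2 ^ (L.-1)./2.
  by have := ltn_expl (L.-1)./2 (ltnSn 1); lia.
rewrite mulnA [2 ^ uphalf _ * L]mulnC expnD mulnCA mulnA.
have -> : 2 ^ (K + m)./2 * 8 * 2 ^ (K %/ m) =
  (2 ^ (K + m)./2 * 4) * 2 ^ (K %/ m).+1 by rewrite expnS; lia.
apply: leq_mul; last by rewrite leq_exp2l // ltnS leq_div2l.
apply: leq_trans (leq_mul L2 (leqnn _)) _.
have -> : 2 ^ (K + m)./2 * 4 = 2 ^ ((K + m)./2 + 2) by rewrite expnD.
by rewrite -expnS -expnD leq_exp2l //; lia.
Qed.

Lemma card_independent_sum_graph_ge (K m : nat) :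
  2 ^ (K + m)./2 <= #|independent_sets (sum_graph (K + m) K m) setT|.
Proof.
have -> : (K + m)./2 = #|ord_itv (K + m) (uphalf (K + m)) (K + m)|.
  by rewrite card_ord_itv; lia.
rewrite -card_powerset; apply/subset_leq_card/subsetP => A.
rewrite powersetE => /subsetP sA; apply/independent_setsP; split=> // x y.
by move=> /sA + /sA; rewrite !ord_itvE /sum_graph; lia.
Qed.

(** * Peeling both ends of the interval *)

(** Stated for maps of natural numbers, because the shifts that are needed go
between ordinals with different bounds. *)
Lemma sum_graph_transport (n n' K K' m : nat) (D : {set 'I_n}) (D' : {set 'I_n'})
    (f : nat -> nat) :
    {in D &, forall x y : 'I_n, f x = f y -> x = y} ->
    (forall x : 'I_n, x \in D -> exists2 y : 'I_n', y \in D' & val y = f x) ->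
    (forall x y : 'I_n, x \in D -> y \in D -> K' <= f x + f y < K' + m ->
      K <= x + y < K + m) ->
  #|independent_sets (sum_graph n K m) D| <=
  #|independent_sets (sum_graph n' K' m) D'|.
Proof.
move=> injf fD ef.
have [->|/set0Pn[x0 /fD[y0 _ _]]] := eqVneq D set0.
  apply: leq_trans (card_independent_sets_le _ _) _.
  rewrite cards0 expn0; apply/card_gt0P; exists set0.
  by apply/independent_setsP; rewrite sub0set; split=> // x y; rewrite inE.
pose g (x : 'I_n) : 'I_n' := insubd y0 (f x).
have gE x : x \in D -> val (g x) = f x.
  by move=> /fD[y _ yE]; rewrite /g val_insubd -yE ltn_ord.
apply: (independent_sets_transport (f := g)).
- by move=> x y xD yD /(congr1 val); rewrite !gE //; exact: injf.
- move=> x xD; have [y yD' yE] := fD x xD.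
  by rewrite (_ : g x = y) //; apply: val_inj; rewrite gE.
- by move=> x y xD yD; rewrite /sum_graph !gE //; exact: ef.
Qed.

Definition missing_count (K m : nat) : nat :=
  #|independent_sets (sum_graph (K + m) K m) setT|.

(** The vertices are split into the two ends, the middle [l, k + l) and a block
of [m] elements just above the middle, whose subsets are counted trivially.
Two elements of the same end are never joined, neither here nor in the graph for
[2 * l], so shifting the upper end by [k], the difference of the two windows,
preserves the edges. *)
Lemma missing_count_leM (m k l : nat) :
  missing_count (k + l.*2) m <=
  2 ^ m * (missing_count k m * missing_count l.*2 m).
Proof.
rewrite /missing_count; set n := k + l.*2 + m.
have -> : [set: 'I_n] = ord_itv n (k + l) (k + l + m) :|:
    (ord_itv n l (k + l) :|: (ord_itv n 0 l :|: ord_itv n (k + l + m) n)).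
  by apply/setP => x; rewrite !inE; have := ltn_ord x; lia.
apply: leq_trans (card_independent_setsU _ _ _) (leq_mul _ _).
  apply: leq_trans (card_independent_itv_le _ _ _) _.
  by rewrite leq_exp2l //; lia.
apply: leq_trans (card_independent_setsU _ _ _) (leq_mul _ _).
  apply: (sum_graph_transport (f := fun x => x - l)).
  - by move=> x y; rewrite !ord_itvE => ? ? ?; apply: val_inj => /=; lia.
  - move=> x; rewrite ord_itvE => xI; have lt : x - l < k + m by lia.
    by exists (Ordinal lt).
  - by move=> x y; rewrite !ord_itvE; lia.
apply: (sum_graph_transport (f := fun x => if x < l then x else x - k)).
- move=> x y; rewrite !inE => ? ?.
  by case: (ltnP x l) => ?; case: (ltnP y l) => ? ?; apply: val_inj => /=; lia.
- move=> x; rewrite !inE => xI.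
  have lt : (if x < l then x : nat else x - k) < l.*2 + m.
    by have := ltn_ord x; rewrite /n; case: ifP; lia.
  by exists (Ordinal lt).
- by move=> x y; rewrite !inE; case: (ltnP x l) => ?; case: (ltnP y l) => ?; lia.
Qed.

(** Conversely, once the block above the middle is empty, no edge joins the
middle to the ends: sums with the lower end are below the window and sums with
the upper end are above it. Emptying a block of [m] elements in each of the two
factors costs at most [2 ^ m] each. *)
Lemma missing_count_geM (m k l : nat) :
  missing_count k m * missing_count l.*2 m <=
  2 ^ m.*2 * missing_count (k + l.*2) m.
Proof.
rewrite /missing_count; set n := k + l.*2 + m.
pose Mid := ord_itv n l (k + l).
pose Ends := ord_itv n 0 l :|: ord_itv n (k + l + m) n.
have leMid : #|independent_sets (sum_graph (k + m) k m) setT| <=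
    2 ^ m * #|independent_sets (sum_graph n (k + l.*2) m) Mid|.
  have -> : [set: 'I_(k + m)] = ord_itv (k + m) k (k + m) :|: ord_itv (k + m) 0 k.
    by apply/setP => x; rewrite !inE; have := ltn_ord x; lia.
  apply: leq_trans (card_independent_setsU _ _ _) (leq_mul _ _).
    apply: leq_trans (card_independent_itv_le _ _ _) _.
    by rewrite leq_exp2l //; lia.
  apply: (sum_graph_transport (f := fun x => x + l)).
  - by move=> x y; rewrite !ord_itvE => ? ? ?; apply: val_inj => /=; lia.
  - move=> x; rewrite ord_itvE => xI; have lt : x + l < n by rewrite /n; lia.
    by exists (Ordinal lt); rewrite ?ord_itvE /=; lia.
  - by move=> x y; rewrite !ord_itvE; lia.
have leEnds : #|independent_sets (sum_graph (l.*2 + m) l.*2 m) setT| <=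
    2 ^ m * #|independent_sets (sum_graph n (k + l.*2) m) Ends|.
  have -> : [set: 'I_(l.*2 + m)] = ord_itv (l.*2 + m) l (l + m) :|:
      (ord_itv (l.*2 + m) 0 l :|: ord_itv (l.*2 + m) (l + m) (l.*2 + m)).
    by apply/setP => x; rewrite !inE; have := ltn_ord x; lia.
  apply: leq_trans (card_independent_setsU _ _ _) (leq_mul _ _).
    apply: leq_trans (card_independent_itv_le _ _ _) _.
    by rewrite leq_exp2l //; lia.
  apply: (sum_graph_transport (f := fun x => if x < l then x else x + k)).
  - move=> x y; rewrite !inE => ? ?.
    by case: (ltnP x l) => ?; case: (ltnP y l) => ? ?; apply: val_inj => /=; lia.
  - move=> x; rewrite !inE => xI.
    have lt : (if x < l then x : nat else x + k) < n.
      by rewrite /n; case: ifP; lia.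
    by exists (Ordinal lt); rewrite // !inE /n /=; case: ifP; lia.
  - by move=> x y; rewrite !inE; case: (ltnP x l) => ?; case: (ltnP y l) => ?; lia.
apply: leq_trans (leq_mul leMid leEnds) _.
rewrite mulnACA -expnD addnn leq_mul2l; apply/orP; right.
apply: leq_trans (card_independent_setsU_ge _ _) (independent_setsS _ (subsetT _)).
  by apply/setP => x; rewrite !inE; lia.
by move=> x y; rewrite !inE /sum_graph /n; lia.
Qed.

Lemma missing_setsE (K m : nat) :
  missing_sets (K + m) (iota K m) = independent_sets (sum_graph (K + m) K m) setT.
Proof.
apply/setP => A; rewrite [LHS]inE; apply/allP/independent_setsP => [missA|].
  split=> [|x y xA yA]; first exact: subsetT.
  apply/negP => exy; have := missA (x + y); rewrite mem_iota => /(_ exy)/negP[].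
  by apply/exists_inP; exists x => //; apply/exists_inP; exists y.
move=> [_ indA] b; rewrite mem_iota => bI.
apply/exists_inP => -[x xA /exists_inP[y yA /eqP xyb]].
by have := indA x y xA yA; rewrite /sum_graph xyb bI.
Qed.

End Counting.

Section Probability.
Set Implicit Arguments.
Unset Strict Implicit.
Unset Printing Implicit Defensive.

(** * Bounds on the probability *)

Lemma missing_prob_iota (R : realType) (K m : nat) : (0 < m)%N ->
  missing_prob R (iota K m) = (missing_count K m)%:R / 2 ^+ (K + m).
Proof.
move=> m0; rewrite -(@missing_prob_inE _ (K + m)); last 2 first.
- by apply/allP => b; rewrite mem_iota; lia.
- by lia.
by rewrite /missing_prob_in missing_setsE card_set_type card_ord natrX.
Qed.

Lemma missing_prob_iota_quasimul (R : realType) (m k l : nat) : (0 < m)%N ->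
  missing_prob R (iota (k + l.*2) m) <= 2 ^+ m.*2 *
    (missing_prob R (iota k m) * missing_prob R (iota l.*2 m)) /\
  missing_prob R (iota k m) * missing_prob R (iota l.*2 m) <=
    2 ^+ m.*2 * missing_prob R (iota (k + l.*2) m).
Proof.
move=> m0; rewrite !missing_prob_iota //.
have := missing_count_leM m k l; have := missing_count_geM m k l.
rewrite -(ler_nat R) -[in X in _ -> X](ler_nat R) !natrM !natrX.
set Nk := (missing_count k m)%:R; set Nl := (missing_count l.*2 m)%:R.
set N := (missing_count (k + l.*2) m)%:R => geM leM.
have pow_gt0 n : 0 < 2 ^+ n :> R by rewrite exprn_gt0.
have m1 : 1 <= 2 ^+ m :> R by rewrite exprn_ege1 // ler1n.
have -> : Nk / 2 ^+ (k + m) * (Nl / 2 ^+ (l.*2 + m)) =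
    Nk * Nl / 2 ^+ m / 2 ^+ (k + l.*2 + m) :> R.
  rewrite !exprD; field.
  by rewrite !gt_eqF.
split; rewrite mulrA ler_pM2r ?invr_gt0 //.
  rewrite -addnn exprD; apply: le_trans leM _.
  by rewrite le_eqVlt; apply/orP; left; apply/eqP; field; rewrite gt_eqF.
rewrite ler_pdivrMr //; apply: le_trans geM _; rewrite ler_peMr //.
by rewrite mulr_ge0 // ltW.
Qed.

(** Abstract numbers [h] and [t] stand for [2 ^ (- 1 / 2)] and [2 ^ (1 / m)], so that
only integer powers occur. *)
Lemma missing_prob_iota_bounds (R : realType) (K m : nat) (h t : R) :
    (0 < m)%N -> 0 < h -> h ^+ 2 = 1 / 2 -> 1 <= t -> t ^+ m = 2 ->
  h ^+ (K + m).+1 <= missing_prob R (iota K m) <= 9 * t ^+ K * h ^+ (K + m).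
Proof.
move=> m0 h0 h2 t1 tm; rewrite missing_prob_iota //.
have hpow n : h ^+ n.*2 = (2 ^+ n)^-1 by rewrite -mul2n exprM h2 div1r exprVn.
have h1 : h <= 1 by rewrite leNgt; apply/negP => lt1h; move: h2; rewrite expr2; nra.
have pow0 n : 0 < 2 ^+ n :> R by rewrite exprn_gt0.
have halfE : 2 ^+ (K + m)./2 / 2 ^+ (K + m) = h ^+ (uphalf (K + m)).*2 :> R.
  have -> : 2 ^+ (K + m) = 2 ^+ (K + m)./2 * 2 ^+ uphalf (K + m) :> R.
    by rewrite -exprD; congr (_ ^+ _); lia.
  by rewrite hpow invfM mulVKf // gt_eqF.
apply/andP; split.
  apply: le_trans (_ : 2 ^+ (K + m)./2 / 2 ^+ (K + m) <= _); last first.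
    by rewrite ler_pM2r ?invr_gt0 // -natrX ler_nat card_independent_sum_graph_ge.
  by rewrite halfE ler_wiXn2l // ?ltW //; lia.
apply: le_trans (_ : 9 * 2 ^+ ((K + m)./2 + K %/ m) / 2 ^+ (K + m) <= _).
  rewrite ler_pM2r ?invr_gt0 // -natrX -natrM ler_nat.
  exact: card_independent_sum_graph_le.
have -> : 9 * 2 ^+ ((K + m)./2 + K %/ m) / 2 ^+ (K + m) =
    9 * 2 ^+ (K %/ m) * (2 ^+ (K + m)./2 / 2 ^+ (K + m)) :> R by rewrite exprD; ring.
rewrite halfE; apply: ler_pM; rewrite ?mulr_ge0 ?exprn_ge0 //; first exact: ltW.
  by rewrite ler_pM2l // -tm -exprM ler_weXn2l // mulnC leq_trunc_div.
by rewrite ler_wiXn2l // ?ltW //; lia.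
Qed.

(** * Exponential growth of quasi-multiplicative sequences *)

(** Fekete's lemma, two-sided. Put [a l = ln (q l)] and [c = ln C]. Then
[a l - c] is superadditive and [a l + c] is subadditive; comparing both at the
product of two indices shows that every quotient [(a l - c) / l] is below every
quotient [(a l' + c) / l']. Any number between the two families is the logarithm
of the ratio; the supremum of the first is one. *)
Lemma quasi_multiplicative_growth (R : realType) (q : nat -> R) (C : R) :
    (forall l, 0 < q l) ->
    (forall a b, q (a + b)%N <= C * (q a * q b)) ->
    (forall a b, q a * q b <= C * q (a + b)%N) ->
  exists2 rho, 0 < rho & forall l, rho ^+ l <= C * q l /\ q l <= C * rho ^+ l.
Proof.
move=> q0 leM geM.
have C0 : 0 < C.
  by have := lt_le_trans (q0 _) (leM 0 0)%N; rewrite pmulr_lgt0 // mulr_gt0.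
have qpos l : q l \is Num.pos by rewrite posrE.
have lnq a b : ln (q a) + ln (q b) - ln C <= ln (q (a + b)%N)
            <= ln (q a) + ln (q b) + ln C.
  have := leM a b; have := geM a b.
  rewrite -ler_ln ?posrE ?mulr_gt0 // lnM // lnM ?posrE //.
  rewrite -[in X in _ -> X -> _]ler_ln ?posrE ?mulr_gt0 //.
  by rewrite lnM ?posrE ?mulr_gt0 // lnM //; lra.
pose u l := ln (q l) - ln C; pose w l := ln (q l) + ln C.
have u_super n l : n.+1%:R * u l <= u (n.+1 * l)%N.
  elim: n => [|n IHn]; first by rewrite mul1r mul1n.
  rewrite mulSn -[n.+2]add1n natrD mulrDl mul1r.
  have /andP[] := lnq l (n.+1 * l)%N; rewrite /u in IHn *; lra.
have w_sub n l : w (n.+1 * l)%N <= n.+1%:R * w l.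
  elim: n => [|n IHn]; first by rewrite mul1r mul1n.
  rewrite mulSn -[n.+2]add1n natrD mulrDl mul1r.
  have /andP[] := lnq l (n.+1 * l)%N; rewrite /w in IHn *; lra.
have C1 : 0 <= ln C by have /andP[] := lnq 0 0; lra.
have cross a b : u a.+1 / a.+1%:R <= w b.+1 / b.+1%:R.
  rewrite ler_pdivrMr // mulrAC ler_pdivlMr // mulrC [leRHS]mulrC.
  apply: le_trans (u_super _ _) _; apply: le_trans (w_sub _ _).
  by rewrite mulnC /u /w; lra.
pose U := [set x : R | exists a, x = u a.+1 / a.+1%:R].
have Uub b : ubound U (w b.+1 / b.+1%:R) by move=> _ [a ->]; exact: cross.
pose alpha := sup U; exists (expR alpha); first exact: expR_gt0.
have uw l : u l <= l%:R * alpha <= w l.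
  case: l => [|l].
    rewrite mul0r /u /w; have := lnq 0 0; lra.
  have le_alpha : u l.+1 / l.+1%:R <= alpha.
    by apply: ub_le_sup; [exists (w 1%N / 1%:R); exact: Uub | exists l].
  have alpha_le : alpha <= w l.+1 / l.+1%:R.
    by apply: ge_sup (Uub l); exists (u 1%N / 1%:R); exists 0%N.
  by rewrite mulrC -ler_pdivrMr // le_alpha -ler_pdivlMr.
move=> l; rewrite -expRM_natl; have /andP[ul wl] := uw l.
rewrite /u /w in ul wl; split.
  have -> : C * q l = expR (ln C + ln (q l)) by rewrite expRD !lnK ?posrE.
  by rewrite ler_expR; lra.
have -> : C * expR (l%:R * alpha) = expR (ln C + l%:R * alpha).
  by rewrite expRD lnK ?posrE.
by rewrite -[leLHS](lnK (qpos l)) ler_expR; lra.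
Qed.

(** The even-indexed subsequence is quasi-multiplicative, with ratio [rho] say,
and [f (e + 2 * l)] is comparable to [f e * f (2 * l)]; the growth rate is
therefore the square root of [rho], with one pair of constants for each
parity [e]. *)
Lemma growth_rate_exists (R : realType) (m : nat) : (0 < m)%N ->
  exists l : R, is_growth_rate (iota 0 m) l.
Proof.
move=> m0; pose f k := missing_prob R (iota k m).
pose C : R := 2 ^+ m.*2; have C0 : 0 < C by rewrite exprn_gt0.
have f0 k : 0 < f k by exact: missing_prob_gt0.
have leM k l : f (k + l.*2)%N <= C * (f k * f l.*2).
  by have [] := missing_prob_iota_quasimul R k l m0.
have geM k l : f k * f l.*2 <= C * f (k + l.*2)%N.
  by have [] := missing_prob_iota_quasimul R k l m0.
have fE k : missing_prob R (iota k m) = f k by [].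
(* Only the quasi-multiplicativity of [f] matters from here on. *)
move: f f0 leM geM fE => f f0 leM geM fE.
have [|a b|a b|rho rho0 rhoP] := @quasi_multiplicative_growth R (fun l => f l.*2) C.
- by move=> l; exact: f0.
- by rewrite doubleD; exact: leM.
- by rewrite doubleD; exact: geM.
pose s := Num.sqrt rho; have s0 : 0 < s by rewrite sqrtr_gt0.
have sE l : s ^+ l.*2 = rho ^+ l by rewrite -mul2n exprM sqr_sqrtr // ltW.
pose cmin e := f e / (C * C * s ^+ e); pose cmax e := C * C * f e / s ^+ e.
have bounds e l :
    cmin e * s ^+ (e + l.*2) <= f (e + l.*2)%N <= cmax e * s ^+ (e + l.*2).
  have [qlo qhi] := rhoP l; have se0 : 0 < s ^+ e by rewrite exprn_gt0.
  rewrite exprD sE /cmin /cmax; apply/andP; split.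
    have -> : f e / (C * C * s ^+ e) * (s ^+ e * rho ^+ l) =
        f e * rho ^+ l / C / C by field; rewrite !gt_eqF.
    rewrite !ler_pdivrMr //.
    apply: le_trans (_ : C * (f e * f l.*2) <= _); first by rewrite mulrCA ler_pM2l.
    by rewrite -mulrA [leRHS]mulrC -mulrA ler_pM2l.
  have -> : C * C * f e / s ^+ e * (s ^+ e * rho ^+ l) =
      C * (f e * (C * rho ^+ l)) by field; rewrite gt_eqF.
  by apply: le_trans (leM e l) _; rewrite ler_pM2l // ler_pM2l.
have cmin0 e : 0 < cmin e by rewrite divr_gt0 ?mulr_gt0 ?exprn_gt0.
have cmax0 e : 0 < cmax e by rewrite divr_gt0 ?mulr_gt0 ?exprn_gt0.
exists s; exists (Num.min (cmin 0%N) (cmin 1%N)), (Num.max (cmax 0%N) (cmax 1%N)).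
split; [by rewrite lt_min !cmin0|by rewrite lt_max cmax0|move=> k].
rewrite -iotaDl addn0 fE -(odd_double_half k).
have /andP[lo hi] := bounds (odd k) k./2.
have sk0 : 0 < s ^+ (odd k + k./2.*2)%N by rewrite exprn_gt0.
split; [apply: le_trans lo|apply: le_trans hi _]; rewrite ler_pM2r //.
  by case: (odd k); rewrite ge_min lexx ?orbT.
by case: (odd k); rewrite le_max lexx ?orbT.
Qed.

Lemma lambdaP (R : realType) (m : nat) : (0 < m)%N ->
  is_growth_rate (iota 0 m) (lambda R (iota 0 m)).
Proof.
move=> /(growth_rate_exists R)[l gl].
exact: (@xgetPex _ 0 [set l : R | is_growth_rate (iota 0 m) l] (ex_intro _ l gl)).
Qed.

Lemma geometric_le (R : realType) (c d u v : R) :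
    0 < c -> 0 < d -> 0 < u -> 0 < v ->
    (forall k, c * u ^+ k <= d * v ^+ k) -> u <= v.
Proof.
move=> c0 d0 u0 v0 le_cd; rewrite leNgt; apply/negP => ltvu.
pose x := ln u - ln v.
have x0 : 0 < x by rewrite subr_gt0 ltr_ln ?posrE.
have uE : u = expR x * v by rewrite /x expRB !lnK ?posrE // divfK // gt_eqF.
have /archi_boundP : 0 <= d / c / x by rewrite !divr_ge0 // ltW.
set k := Num.Def.archi_bound _ => ltk.
have := le_cd k.+1.
rewrite uE exprMn mulrA ler_pM2r ?exprn_gt0 // -expRM_natl mulrC -ler_pdivlMr //.
apply/negP; rewrite -ltNge; apply: lt_le_trans (expR_ge1Dx _).
move: ltk; rewrite ltr_pdivrMr // -natr1; lra.
Qed.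

Lemma powR_invn_exp (R : realType) (a : R) (m : nat) :
  0 <= a -> (0 < m)%N -> (a `^ (1 / m%:R)) ^+ m = a.
Proof.
move=> a0 m0; rewrite -powR_mulrn ?powR_ge0 // -powRrM mul1r mulVf ?powRr1 //.
by rewrite pnatr_eq0 -lt0n.
Qed.

Lemma powR_invn_ge1 (R : realType) (a : R) (m : nat) :
  1 <= a -> 1 <= a `^ (1 / m%:R).
Proof.
by move=> a1; rewrite -[leLHS](powRr0 a); apply: ler_powR.
Qed.

(** Through [a `^ (1 / m) = expR (ln a / m)] this is the continuity of the
exponential at 0. *)
Lemma powR_invn_cvg1 (R : realType) (a : R) :
  0 < a -> a `^ (1 / m%:R) @[m --> \oo] --> (1 : R).
Proof.
move=> a0; rewrite -cvg_shiftS /=.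
have -> : (fun m => a `^ (1 / m.+1%:R)) =
    (fun m => expR (harmonic m * ln a)) :> (nat -> R).
  by apply/funext => m; rewrite /powR gt_eqF // div1r.
rewrite -expR0; apply: continuous_cvg; first exact: continuous_expR.
rewrite -(mul0r (ln a)); apply: cvgMl; exact: cvg_harmonic.
Qed.

(** Two sequences comparable to geometric ones are ordered like their ratios, so
the bounds on the probabilities pass to their growth rate. *)
Lemma lambda_bounds (R : realType) (m : nat) :
  (1 / 2) `^ (1 / 2) <= lambda R (iota 0 m.+1) <=
  2 `^ (1 / m.+1%:R) * (1 / 2) `^ (1 / 2).
Proof.
set h : R := (1 / 2) `^ (1 / 2); set t : R := 2 `^ (1 / m.+1%:R).
have gl := lambdaP R (ltn0Sn m); have l0 := is_growth_rate_gt0 gl.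
have [c1 [c2 [c10 c20 rate]]] := gl; move: l0 rate.
set l := lambda _ _ => l0 rate {gl}.
have h0 : 0 < h by exact: powR_gt0.
have h2 : h ^+ 2 = 1 / 2 by exact: powR_invn_exp.
have t1 : 1 <= t by apply: powR_invn_ge1; lra.
have tm : t ^+ m.+1 = 2 by exact: powR_invn_exp.
have bounds k := missing_prob_iota_bounds k (ltn0Sn m) h0 h2 t1 tm.
have t0 : 0 < t by exact: lt_le_trans t1.
apply/andP; split.
  apply: (@geometric_le _ (h ^+ m.+2) c2) => // [|k]; first exact: exprn_gt0.
  have [_ hi] := rate k; have /andP[lo _] := bounds k.
  apply: le_trans hi; rewrite -iotaDl addn0 -exprD.
  by rewrite (_ : m.+2 + k = (k + m.+1).+1)%N //; lia.
apply: (@geometric_le _ c1 (9 * h ^+ m.+1)) => //; rewrite ?mulr_gt0 ?exprn_gt0 //.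
move=> k; have [lo _] := rate k; have /andP[_ hi] := bounds k.
apply: le_trans lo _; rewrite -iotaDl addn0 (le_trans hi) //.
by rewrite exprMn exprD le_eqVlt; apply/orP; left; apply/eqP; ring.
Qed.

End Probability.

Theorem theorem1p7 (R : realType) :
  (exists (c1 c2 : R) (eps : nat -> R),
     0 < c1 /\ 0 < c2 /\
     (forall m : nat, 0 <= eps m) /\
     (eps m @[m --> \oo] --> (0 : R)) /\
     (forall m : nat, (1 <= m)%N -> 1 + eps m = 2 `^ (1 / m%:R)) /\
     (forall k m : nat, (1 <= m)%N ->
        c1 * (1 / 2) `^ ((k + m)%N%:R / 2) <= missing_prob R (iota k.+1 m) /\
        missing_prob R (iota k.+1 m)
          <= c2 * (1 / 2) `^ ((k + m)%N%:R / 2) * (1 + eps m) ^+ k /\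
        missing_prob R (iota k.+1 m)
          <= c2 * (1 / 2) `^ ((k + m)%N%:R / 2) * 2 `^ (k%:R / m%:R))) /\
  (lambda R (iota 0 m.+1) @[m --> \oo] --> ((1 / 2) `^ (1 / 2) : R)).
Proof.
have cvg_t : 2 `^ (1 / m%:R) @[m --> \oo] --> (1 : R) by exact: powR_invn_cvg1.
set h : R := (1 / 2) `^ (1 / 2).
have h0 : 0 < h by exact: powR_gt0.
have h2 : h ^+ 2 = 1 / 2 by exact: powR_invn_exp.
split; last first.
  apply: (squeeze_cvgr (f := fun=> h) (h := fun m => 2 `^ (1 / m.+1%:R) * h)).
  - by apply: nearW => m; exact: lambda_bounds.
  - exact: cvg_cst.
  - rewrite -[X in _ --> X]mul1r; apply: cvgMl.
    by move: cvg_t; rewrite -cvg_shiftS.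
(* The window starts at [K = k + 1]. In the lower bound [h ^+ (K + m).+1] is
   [h ^+ 2 = 1 / 2] times [h ^+ (k + m)]; in the upper bound
   [9 * t ^+ K * h ^+ (K + m)] the additional factor [t * h] is at most 2. *)
exists (1 / 2), 18, (fun m => 2 `^ (1 / m%:R) - 1).
split; first by lra.
split; first by lra.
split; first by move=> m; rewrite subr_ge0 powR_invn_ge1 //; lra.
split; first by rewrite -(subrr 1); apply: cvgB => //; exact: cvg_cst.
split; first by move=> m _; rewrite subrKC.
move=> k m m0; rewrite subrKC.
set t : R := 2 `^ (1 / m%:R).
have t1 : 1 <= t by apply: powR_invn_ge1; lra.
have tm : t ^+ m = 2 by exact: powR_invn_exp.
have t2 : t <= 2 by rewrite -tm -{1}[t]expr1 ler_weXn2l.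
have -> : (1 / 2) `^ ((k + m)%N%:R / 2) = h ^+ (k + m).
  by rewrite -powR_mulrn ?powR_ge0 // /h -powRrM mul1r mulrC.
have -> : 2 `^ (k%:R / m%:R) = t ^+ k.
  by rewrite -powR_mulrn ?powR_ge0 // /t -powRrM mul1r mulrC.
have /andP[lo hi] := missing_prob_iota_bounds k.+1 m0 h0 h2 t1 tm.
have upper : missing_prob R (iota k.+1 m) <= 18 * h ^+ (k + m) * t ^+ k.
  apply: le_trans hi _; rewrite addSn !exprS.
  have : 0 < h ^+ (k + m) by rewrite exprn_gt0.
  have : 0 < t ^+ k by rewrite exprn_gt0 // (lt_le_trans _ t1).
  have h1 : h <= 1 by move: h2; rewrite expr2; nra.
  move: (t ^+ k) (h ^+ (k + m)) => T H T0 H0.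
  have TH0 : 0 < T * H by exact: mulr_gt0.
  have : t * h <= 2 by nra.
  nra.
split=> //; apply: le_trans lo.
by rewrite addSn !exprS mulrA -expr2 h2.
Qed.
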